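(* For every hpgcl-program $c$ and all expectations $X,Y\in\mathbb{E}$ with $\mathrm{Mod}(c)\cap\mathrm{Vars}(Y)=\emptyset$: $\mathrm{wp}[c](X)\star Y\preceq\mathrm{wp}[c](X\star Y)$.
   Context: Programs of hpgcl: $c::=\mathtt{skip}\mid x:=e\mid c;c\mid\mathtt{if}\,(b)\,\{c\}\,\mathtt{else}\,\{c\}\mid\mathtt{while}\,(b)\,\{c\}\mid\{c\}\,[p]\,\{c\}\mid x:=\mathtt{new}(e_1,\dots,e_n)\mid\langle e\rangle:=e'\mid x:=\langle e\rangle\mid\mathtt{free}(e)$, with $x$ a variable, $e,e',e_i$ arithmetic expressions over variables, $b$ a Boolean guard over variables, $p\in[0,1]\cap\mathbb{Q}$. $\mathrm{Mod}(c)$ is the set of variables $x$ occurring on the left of $x:=e$, $x:=\mathtt{new}(\dots)$ or $x:=\langle e\rangle$ in $c$. States are pairs $(s,h)$ of a stack $s:\mathrm{Vars}\to\mathbb{Z}$ and a heap $h:N\to\mathbb{Z}$, $N=\mathrm{dom}(h)\subseteq\mathbb{N}_{>0}$ finite; $\Sigma$ is the set of states; $s(e)$ is the value of $e$; heaps are disjoint ($\perp$) if their domains are and $h_1\star h_2$ is their union. $\mathbb{E}$ is the set of functions $\Sigma\to\mathbb{R}_{\ge0}\cup\{\infty\}$ ordered pointwise by $\preceq$; arithmetic, $\sup$, $\inf$ pointwise, $0\cdot\infty=0$; $[\varphi]$ is the indicator of predicate $\varphi$. $\mathrm{Vars}(Y)$ is the set of $x$ such that $Y(s[x\mapsto v],h)\neq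 Y(s[x\mapsto v'],h)$ for some $(s,h)$ and $v,v'\in\mathbb{Z}$. $(X\star Y)(s,h)=\max\{X(s,h_1)\cdot Y(s,h_2)\mid h=h_1\star h_2\}$; $([\varphi]\mathbin{-\!\!\star}X)(s,h)=\inf\{X(s,h\star h')\mid h'\perp h,\ (s,h')\models\varphi\}$, $\inf\emptyset=\infty$. $[e\mapsto e_1,\dots,e_n](s,h)=1$ iff $\mathrm{dom}(h)=\{s(e),\dots,s(e)+n-1\}$ and $h(s(e)+i-1)=s(e_i)$ for all $i$; $[e\mapsto -](s,h)=1$ iff $\mathrm{dom}(h)=\{s(e)\}$. $X[x/e]=\lambda(s,h).X(s[x\mapsto s(e)],h)$. $\mathrm{wp}[c]:\mathbb{E}\to\mathbb{E}$: $\mathrm{wp}[\mathtt{skip}](X)=X$; $\mathrm{wp}[x:=e](X)=X[x/e]$; $\mathrm{wp}[c_1;c_2](X)=\mathrm{wp}[c_1](\mathrm{wp}[c_2](X))$; $\mathrm{wp}[\mathtt{if}\,(b)\,\{c_1\}\,\mathtt{else}\,\{c_2\}](X)=[b]\cdot\mathrm{wp}[c_1](X)+[\neg b]\cdot\mathrm{wp}[c_2](X)$; $\mathrm{wp}[\mathtt{while}\,(b)\,\{c'\}](X)=\mathrm{lfp}\,Y.\,[\neg b]\cdot X+[b]\cdot\mathrm{wp}[c'](Y)$; $\mathrm{wp}[\{c_1\}[p]\{c_2\}](X)=p\cdot\mathrm{wp}[c_1](X)+(1-p)\cdot\mathrm{wp}[c_2](X)$; $\mathrm{wp}[x:=\mathtt{new}(e_1,\dots,e_n)](X)(s,h)=\inf\{([v\mapsto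 e_1,\dots,e_n]\mathbin{-\!\!\star}X[x/v])(s,h)\mid v\in\mathbb{N}_{>0},\ v,\dots,v+n-1\notin\mathrm{dom}(h)\}$; $\mathrm{wp}[x:=\langle e\rangle](X)=\sup_{v\in\mathbb{Z}}[e\mapsto v]\star([e\mapsto v]\mathbin{-\!\!\star}X[x/v])$; $\mathrm{wp}[\langle e\rangle:=e'](X)=[e\mapsto -]\star([e\mapsto e']\mathbin{-\!\!\star}X)$; $\mathrm{wp}[\mathtt{free}(e)](X)=[e\mapsto -]\star X$. *)

(* Defs.v *)
From HB Require Import structures.
From mathcomp Require Import all_boot all_order all_algebra finmap.
From mathcomp Require Import all_classical all_reals all_analysis.

Set Implicit Arguments.
Unset Strict Implicit.
Unset Printing Implicit Defensive.

Import Order.TTheory GRing.Theory Num.Theory.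

Local Open Scope classical_set_scope.
Local Open Scope ring_scope.

(* The language does not fix the arithmetic operations and comparisons that
   may occur in expressions and guards: any function on the integers is
   allowed. *)
Inductive aexp (V : Type) : Type :=
| AVar of V
| AConst of int
| AUn of (int -> int) & aexp V
| ABin of (int -> int -> int) & aexp V & aexp V.

Arguments AConst {V}.

Inductive bexp (V : Type) : Type :=
| BConst of bool
| BCmp of rel int & aexp V & aexp V
| BNot of bexp V
| BAnd of bexp V & bexp V
| BOr of bexp V & bexp V.

Definition prob : Type := {p : rat | 0 <= p <= 1}.

Inductive cmd (V : Type) : Type :=
| Skip
| Assign of V & aexp V
| Seq of cmd V & cmd V
| If of bexp V & cmd V & cmd V
| While of bexp V & cmd V
| PChoice of cmd V & prob & cmd V
| New of V & seq (aexp V)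
| Mutate of aexp V & aexp V
| Lookup of V & aexp V
| Free of aexp V.

Fixpoint Mod (V : Type) (c : cmd V) : set V :=
  match c with
  | Skip => set0
  | Assign x _ => [set x]
  | Seq c1 c2 => Mod c1 `|` Mod c2
  | If _ c1 c2 => Mod c1 `|` Mod c2
  | While _ c1 => Mod c1
  | PChoice c1 _ c2 => Mod c1 `|` Mod c2
  | New x _ => [set x]
  | Mutate _ _ => set0
  | Lookup x _ => [set x]
  | Free _ => set0
  end.

Definition stack (V : Type) : Type := V -> int.

Definition upd (V : eqType) (s : stack V) (x : V) (v : int) : stack V :=
  fun y => if y == x then v else s y.

Fixpoint aeval (V : Type) (s : stack V) (e : aexp V) : int :=
  match e with
  | AVar x => s x
  | AConst n => n
  | AUn f e1 => f (aeval s e1)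
  | ABin f e1 e2 => f (aeval s e1) (aeval s e2)
  end.

Fixpoint beval (V : Type) (s : stack V) (b : bexp V) : bool :=
  match b with
  | BConst t => t
  | BCmp r e1 e2 => r (aeval s e1) (aeval s e2)
  | BNot b1 => ~~ beval s b1
  | BAnd b1 b2 => beval s b1 && beval s b2
  | BOr b1 b2 => beval s b1 || beval s b2
  end.

(* Addresses are kept in int, so that values of expressions can be compared
   with them, but only positive integers may be allocated. *)
Definition heap : Type :=
  {h : {fmap int -> int} | all (fun l => 0 < l) (domf h)}.

Definition dom (h : heap) : {fset int} := domf (val h).

Definition hdisj (h1 h2 : heap) : Prop := [disjoint dom h1 & dom h2]%fset.

Lemma hunion_subproof (h1 h2 : heap) :
  all (fun l => 0 < l) (domf (catf (val h1) (val h2))).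
Proof.
apply/allP => l; rewrite mem_catf => /orP[] lh.
- by have /allP := valP h1; apply.
- by have /allP := valP h2; apply.
Qed.

(* Only meaningful for disjoint heaps: otherwise h2 takes precedence. *)
Definition hunion (h1 h2 : heap) : heap :=
  exist _ (catf (val h1) (val h2)) (hunion_subproof h1 h2).

Definition state (V : Type) : Type := (stack V * heap)%type.

(* Quantities are total functions to the extended reals; the expectations are
   the nonnegative ones. *)
Definition is_expectation (R : realType) (V : Type) (X : state V -> \bar R) :
  Prop := forall st, (0 <= X st)%E.

Definition exp_le (R : realType) (V : Type) (X Y : state V -> \bar R) : Prop :=
  forall st, (X st <= Y st)%E.

Definition Vars (R : realType) (V : eqType) (Y : state V -> \bar R) : set V :=
  [set x | exists (s : stack V) (h : heap) (v v' : int),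
     Y (upd s x v, h) <> Y (upd s x v', h)].

Definition iverson (R : realType) (V : Type) (phi : set (state V)) :
  state V -> \bar R := fun st => (\1_phi st)%:E.

Definition guard (V : Type) (b : bexp V) : set (state V) :=
  [set st | beval st.1 b].

Definition pointsto (V : Type) (e : aexp V) (es : seq (aexp V)) :
  set (state V) :=
  [set st |
     dom st.2 = [fset (aeval st.1 e + i%:Z)%R | i in iota 0 (size es)]%fset
     /\ forall i, (i < size es)%N ->
          (val st.2).[? (aeval st.1 e + i%:Z)%R]%fmap
            = Some (aeval st.1 (nth e es i))].

Definition pointsto_any (V : Type) (e : aexp V) : set (state V) :=
  [set st | dom st.2 = [fset aeval st.1 e]%fset].

(* A heap has finitely many splittings, so the supremum is a maximum, see
   sepcon_max below. *)
Definition sepcon (R : realType) (V : Type) (X Y : state V -> \bar R) :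
  state V -> \bar R :=
  fun st => ereal_sup
    [set (X (st.1, hh.1) * Y (st.1, hh.2))%E
       | hh in [set hh | hdisj hh.1 hh.2 /\ st.2 = hunion hh.1 hh.2]].

Definition wand (R : realType) (V : Type) (phi : set (state V))
  (X : state V -> \bar R) : state V -> \bar R :=
  fun st => ereal_inf
    [set X (st.1, hunion st.2 h')
       | h' in [set h' | hdisj h' st.2 /\ phi (st.1, h')]].

Definition subst (R : realType) (V : eqType) (X : state V -> \bar R) (x : V)
  (e : aexp V) : state V -> \bar R :=
  fun st => X (upd st.1 x (aeval st.1 e), st.2).

(* If F has a least fixed point among the expectations, then it is the
   pointwise infimum of all the fixed points of F; see wp_while_fix and
   wp_while_least below for the loops. *)
Definition lfp (R : realType) (V : Type)
  (F : (state V -> \bar R) -> (state V -> \bar R)) : state V -> \bar R :=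
  fun st => ereal_inf [set Y st | Y in [set Y | is_expectation Y /\ F Y = Y]].

Fixpoint wp (R : realType) (V : eqType) (c : cmd V) (X : state V -> \bar R) :
  state V -> \bar R :=
  match c with
  | Skip => X
  | Assign x e => subst X x e
  | Seq c1 c2 => wp c1 (wp c2 X)
  | If b c1 c2 => fun st =>
      (iverson R (guard b) st * wp c1 X st
       + iverson R (~` guard b) st * wp c2 X st)%E
  | While b c1 => lfp (fun Y st =>
      (iverson R (~` guard b) st * X st
       + iverson R (guard b) st * wp c1 Y st)%E)
  | PChoice c1 p c2 => fun st =>
      ((ratr (val p))%:E * wp c1 X st + (1 - ratr (val p))%:E * wp c2 X st)%E
  | New x es => fun st => ereal_inf
      [set wand (pointsto (AConst v%:Z) es) (subst X x (AConst v%:Z)) st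
         | v in [set v : nat | (0 < v)%N /\
             forall i, (i < size es)%N -> v%:Z + i%:Z \notin dom st.2]]
  | Mutate e e' =>
      sepcon (iverson R (pointsto_any e)) (wand (pointsto e [:: e']) X)
  | Lookup x e => fun st => ereal_sup
      [set sepcon (iverson R (pointsto e [:: AConst v]))
             (wand (pointsto e [:: AConst v]) (subst X x (AConst v))) st
         | v in [set: int]]
  | Free e => sepcon (iverson R (pointsto_any e)) X
  end.

Lemma hunion_splitting (h1 h2 : heap) : hdisj h1 h2 ->
  (val h1 = (val (hunion h1 h2)).[& dom h1]
   /\ val h2 = (val (hunion h1 h2)).[\ dom h1])%fmap.
Proof.
move=> d; split; apply/fmapP => l.
- rewrite fnd_restrict /= fnd_cat -/(dom h1) -/(dom h2).
  case: ifPn => [l1|l1]; last by rewrite not_fnd.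
  by move/fdisjointP: d => /(_ _ l1)/negbTE ->.
- rewrite fnd_rem /= fnd_cat -/(dom h2).
  case: ifPn => [l1|l1].
    by rewrite not_fnd //; move/fdisjointP: d; apply.
  case: ifPn => // l2.
  by rewrite !not_fnd.
Qed.

Lemma sepcon_max (R : realType) (V : Type) (X Y : state V -> \bar R)
  (st : state V) : exists h1 h2 : heap,
  [/\ hdisj h1 h2, st.2 = hunion h1 h2
    & sepcon X Y st = (X (st.1, h1) * Y (st.1, h2))%E].
Proof.
set A := [set hh : heap * heap | hdisj hh.1 hh.2 /\ st.2 = hunion hh.1 hh.2].
pose f (hh : heap * heap) := (X (st.1, hh.1) * Y (st.1, hh.2))%E.
have finA : finite_set (f @` A).
  apply: finite_image.
  pose g (hh : heap * heap) := (val hh.1, val hh.2).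
  pose r (B : {fset int}) := ((val st.2).[& B], (val st.2).[\ B])%fmap.
  apply: (@sub_finite_set _ _
    (g @^-1` (r @` [set` fpowerset (dom st.2)]))).
    move=> [h1 h2] [/= d e]; exists (dom h1).
      rewrite /= fpowersetE e; apply/fsubsetP => l l1.
      by rewrite /dom mem_catf l1.
    have [e1 e2] := hunion_splitting d.
    by rewrite /r /g /= e -e1 -e2.
  apply: finite_preimage; last by apply: finite_image; exact: finite_fset.
  by move=> [h1 h2] [k1 k2] _ _ [] /val_inj -> /val_inj ->.
have [e0 he0] : exists e0 : {fmap int -> int}, domf e0 = fset0.
  by exists fmap0; rewrite domf0.
have e0P : all (fun l => 0 < l) (domf e0) by rewrite he0; apply/allP => l.
have A0 : A (st.2, exist _ e0 e0P).
  split; first by rewrite /hdisj /dom /= he0 fdisjointX0.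
  apply: val_inj; apply/fmapP => l; rewrite /= fnd_cat.
  by case: ifPn => //; rewrite {1}he0 in_fset0.
have [B fAB] := finite_fsetP.1 finA.
have fA0 : f (st.2, exist _ e0 e0P) \in B.
  have : (f @` A) (f (st.2, exist _ e0 e0P)) by exists (st.2, exist _ e0 e0P).
  by rewrite fAB.
have [m _ mP] := @Order.TotalTheory.arg_maxP _ _ B [` fA0]%fset xpredT val isT.
have : (f @` A) (val m) by rewrite fAB /=; exact: valP.
move=> [[h1 h2] [d e] fm]; exists h1, h2; split => //.
apply/eqP; rewrite eq_le; apply/andP; split.
- rewrite -/(f (h1, h2)) fm; apply: ge_ereal_sup => y.
  rewrite -/A -/f fAB /= => yB.
  exact: (mP [` yB]%fset isT).
- by apply: ereal_sup_ubound; exists (h1, h2).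
Qed.

Lemma iverson_ge0 (R : realType) (V : Type) (phi : set (state V)) :
  is_expectation (iverson R phi).
Proof. by move=> st; rewrite lee_fin indicE ler0n. Qed.

Lemma sepcon_ge0 (R : realType) (V : Type) (X Y : state V -> \bar R) :
  is_expectation X -> is_expectation Y -> is_expectation (sepcon X Y).
Proof.
move=> X0 Y0 st; have [h1 [h2 [_ _ ->]]] := sepcon_max X Y st.
exact: mule_ge0.
Qed.

Lemma sepcon_le (R : realType) (V : Type) (X X' Y Y' : state V -> \bar R) :
  is_expectation X -> is_expectation Y -> exp_le X X' -> exp_le Y Y' ->
  exp_le (sepcon X Y) (sepcon X' Y').
Proof.
move=> X0 Y0 XX' YY' st; apply: ge_ereal_sup => _ [[h1 h2] hh <-].
apply: le_ereal_sup_tmp; eexists; first by exists (h1, h2).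
exact: lee_pmul.
Qed.

Lemma wand_ge0 (R : realType) (V : Type) phi (X : state V -> \bar R) :
  is_expectation X -> is_expectation (wand phi X).
Proof. by move=> X0 st; apply: le_ereal_inf_tmp => _ [h' _ <-]. Qed.

Lemma wand_le (R : realType) (V : Type) phi (X X' : state V -> \bar R) :
  exp_le X X' -> exp_le (wand phi X) (wand phi X').
Proof.
move=> XX' st; apply: le_ereal_inf_tmp => _ [h' hh <-].
by apply: ge_ereal_inf; eexists; first by exists h'.
Qed.

Lemma lfp_ge0 (R : realType) (V : Type)
  (F : (state V -> \bar R) -> (state V -> \bar R)) : is_expectation (lfp F).
Proof. by move=> st; apply: le_ereal_inf_tmp => _ [Y [Y0 _] <-]. Qed.

Section KnasterTarski.
Context (R : realType) (V : Type).
Context (F : (state V -> \bar R) -> (state V -> \bar R)).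
Hypothesis F0 : forall Y, is_expectation Y -> is_expectation (F Y).
Hypothesis FM : forall Y Y', is_expectation Y -> exp_le Y Y' ->
  exp_le (F Y) (F Y').

Let m : state V -> \bar R := fun st =>
  ereal_inf [set Y st | Y in [set Y | is_expectation Y /\ exp_le (F Y) Y]].

Let m_ge0 : is_expectation m.
Proof. by move=> st; apply: le_ereal_inf_tmp => _ [Y [Y0 _] <-]. Qed.

Let m_lb Y : is_expectation Y -> exp_le (F Y) Y -> exp_le m Y.
Proof. by move=> Y0 FY st; apply: ereal_inf_lbound; exists Y. Qed.

Let m_prefix : exp_le (F m) m.
Proof.
move=> st; apply: le_ereal_inf_tmp => _ [Y [Y0 FY] <-].
by apply: le_trans (FY st); apply: FM => //; exact: m_lb.
Qed.

Let m_fix : F m = m.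
Proof.
apply/funext => st; apply/eqP; rewrite eq_le m_prefix /=.
by apply: m_lb => //; [exact: F0|apply: FM => //; exact: F0].
Qed.

Let m_lfp : lfp F = m.
Proof.
apply/funext => st; apply/eqP; rewrite eq_le; apply/andP; split.
  by apply: ereal_inf_lbound; exists m.
apply: le_ereal_inf_tmp => _ [Y [Y0 FY] <-].
by apply: m_lb => // st'; rewrite FY.
Qed.

Lemma lfp_fix : F (lfp F) = lfp F.
Proof. by rewrite m_lfp m_fix. Qed.

Lemma lfp_least Y : is_expectation Y -> exp_le (F Y) Y -> exp_le (lfp F) Y.
Proof. by rewrite m_lfp; exact: m_lb. Qed.

End KnasterTarski.

Lemma prob_ge0 (R : realType) (p : prob) :
  (0 <= ratr (val p) :> R) /\ (0 <= 1 - ratr (val p) :> R).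
Proof.
case: p => p /= /andP[p0 p1]; split; first by rewrite ler0q.
by rewrite subr_ge0 -(rmorph1 (@ratr R)) ler_rat.
Qed.

Lemma wp_ge0_le (R : realType) (V : eqType) (c : cmd V) :
  (forall X : state V -> \bar R, is_expectation X -> is_expectation (wp c X)) /\
  (forall X X' : state V -> \bar R, is_expectation X -> exp_le X X' ->
     exp_le (wp c X) (wp c X')).
Proof.
have iv0 := @iverson_ge0 R V.
elim: c => [|x e|c1 [P1 M1] c2 [P2 M2]|b c1 [P1 M1] c2 [P2 M2]|b c1 [P1 M1]
  |c1 [P1 M1] p c2 [P2 M2]|x es|e e'|x e|e] /=.
- by split.
- by split=> [X X0 st|X X' X0 XX' st]; [exact: X0|exact: XX'].
- split=> [X X0|X X' X0 XX']; first by apply/P1/P2.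
  by apply: M1; [exact: P2|exact: M2].
- split=> [X X0 st|X X' X0 XX' st].
    by apply: adde_ge0; apply: mule_ge0; [exact: iv0|exact: P1|exact: iv0|exact: P2].
  apply: leeD; apply: lee_pmul => //; try exact: iv0.
  - exact: P1.
  - exact: M1.
  - exact: P2.
  - exact: M2.
- split=> [X X0|X X' X0 XX']; first exact: lfp_ge0.
  apply: lfp_least.
  + move=> Y Y0 st.
    by apply: adde_ge0; apply: mule_ge0; [exact: iv0|exact: X0|exact: iv0|exact: P1].
  + move=> Y Y' Y0 YY' st; apply: leeD => //; apply: lee_pmul => //.
    * exact: iv0.
    * exact: P1.
    * exact: M1.
  + exact: lfp_ge0.
  + have X'0 : is_expectation X' by move=> st; exact: le_trans (XX' st).
    rewrite -[X in exp_le _ X]lfp_fix.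
    * move=> st; apply: leeD => //; apply: lee_pmul => //.
      exact: iv0.
    * move=> Y Y0 st.
      by apply: adde_ge0; apply: mule_ge0; [exact: iv0|exact: X'0|exact: iv0|exact: P1].
    * move=> Y Y' Y0 YY' st; apply: leeD => //; apply: lee_pmul => //.
      - exact: iv0.
      - exact: P1.
      - exact: M1.
- have [p0 q0] := prob_ge0 R p.
  split=> [X X0 st|X X' X0 XX' st].
    by apply: adde_ge0; apply: mule_ge0; rewrite ?lee_fin //; [exact: P1|exact: P2].
  apply: leeD; apply: lee_pmul => //; rewrite ?lee_fin //.
  - exact: P1.
  - exact: M1.
  - exact: P2.
  - exact: M2.
- split=> [X X0 st|X X' X0 XX' st].
    by apply: le_ereal_inf_tmp => _ [v _ <-]; apply: wand_ge0 => ?; exact: X0.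
  apply: le_ereal_inf_tmp => _ [v hv <-].
  apply: ge_ereal_inf; eexists; first by exists v.
  by apply: wand_le => ?; exact: XX'.
- split=> [X X0|X X' X0 XX'].
    by apply: sepcon_ge0; [exact: iv0|exact: wand_ge0].
  by apply: sepcon_le => //; [exact: wand_ge0|exact: wand_le].
- split=> [X X0 st|X X' X0 XX' st].
    apply: le_ereal_sup_tmp; eexists; first by exists 0.
    by apply: sepcon_ge0; [exact: iv0|apply: wand_ge0 => ?; exact: X0].
  apply: ge_ereal_sup => _ [v _ <-].
  apply: le_ereal_sup_tmp; eexists; first by exists v.
  apply: sepcon_le => //; first by apply: wand_ge0 => ?; exact: X0.
  by apply: wand_le => ?; exact: XX'.
- split=> [X X0|X X' X0 XX']; first by apply: sepcon_ge0.
  by apply: sepcon_le.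
Qed.

Lemma wp_while_fix (R : realType) (V : eqType) (b : bexp V) (c : cmd V)
  (X : state V -> \bar R) (X0 : is_expectation X) :
  wp (While b c) X =
  (fun st => iverson R (~` guard b) st * X st
             + iverson R (guard b) st * wp c (wp (While b c) X) st)%E.
Proof.
have iv0 := @iverson_ge0 R V; have [P M] := wp_ge0_le R c.
apply/esym/lfp_fix => [Y Y0 st|Y Y' Y0 YY' st].
  by apply: adde_ge0; apply: mule_ge0; [exact: iv0|exact: X0|exact: iv0|exact: P].
apply: leeD => //; apply: lee_pmul => //; first exact: iv0.
  exact: P.
exact: M.
Qed.

Lemma wp_while_least (R : realType) (V : eqType) (b : bexp V) (c : cmd V)
  (X Y : state V -> \bar R) : is_expectation Y ->
  (fun st => iverson R (~` guard b) st * X st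
             + iverson R (guard b) st * wp c Y st)%E = Y ->
  exp_le (wp (While b c) X) Y.
Proof. by move=> Y0 FY st; apply: ereal_inf_lbound; exists Y. Qed.

(* Main.v *)
Require Import Defs.
From HB Require Import structures.
From mathcomp Require Import all_boot all_order all_algebra finmap.
From mathcomp Require Import all_classical all_reals all_analysis.

Set Implicit Arguments.
Unset Strict Implicit.
Unset Printing Implicit Defensive.

Import Order.TTheory GRing.Theory Num.Theory.

Local Open Scope classical_set_scope.
Local Open Scope ring_scope.

(** The proof is by induction on the program. Allocation takes an infimum over
    infinitely many addresses, so [wp] is not continuous and the loop case
    cannot go through the finite iterates of the loop functional. Instead,
    [- ⋆ Y] preserves suprema in its first argument, hence it has a right
    adjoint [magic Y]. With [W := wp (While b c) (sepcon X Y)], the induction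
    hypothesis says that [magic Y W] is a prefixed point of the functional of
    the loop with postexpectation [X], so it is above [wp (While b c) X];
    this is the claim by adjunction. *)

(** For a positive real [y], divide by it. For [y = +oo], a positive element of [A] forces
    [w = +oo], and without one the product is nonpositive. *)
Lemma ereal_sup_mule_le (R : realType) (A : set (\bar R)) (y w : \bar R) :
  (0 <= y)%E -> (0 <= w)%E -> (forall a, A a -> (a * y <= w)%E) ->
  (ereal_sup A * y <= w)%E.
Proof.
move=> y0 w0 Aw; case: y y0 Aw => [r||] // r0 Aw.
- move: r0; rewrite lee_fin le_eqVlt => /predU1P[<-|r0]; first by rewrite mule0.
  rewrite -lee_pdivlMr //; apply: ge_ereal_sup => a Aa.
  by rewrite lee_pdivlMr //; exact: Aw.
- have [A0|] := pselect (forall a, A a -> (a <= 0)%E).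
    apply: le_trans w0; apply: mule_le0_ge0 => //.
    by apply: ge_ereal_sup => a; exact: A0.
  move=> /existsNP[a /not_implyP[Aa /negP]]; rewrite -ltNge => a0.
  by move: (Aw _ Aa); rewrite gt0_muley // leye_eq => /eqP ->; exact: leey.
Qed.

Lemma hdisjC (h1 h2 : heap) : hdisj h1 h2 -> hdisj h2 h1.
Proof. by rewrite /hdisj fdisjoint_sym. Qed.

Lemma dom_hunion (h1 h2 : heap) : dom (hunion h1 h2) = (dom h1 `|` dom h2)%fset.
Proof. by apply/fsetP => l; rewrite mem_catf in_fsetU. Qed.

Lemma hdisjUl (h1 h2 h3 : heap) :
  hdisj (hunion h1 h2) h3 <-> hdisj h1 h3 /\ hdisj h2 h3.
Proof.
by rewrite /hdisj dom_hunion fdisjointUX; split => [/andP//|[-> ->]].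
Qed.

Lemma hdisjUr (h1 h2 h3 : heap) :
  hdisj h1 (hunion h2 h3) <-> hdisj h1 h2 /\ hdisj h1 h3.
Proof.
by rewrite /hdisj dom_hunion fdisjointXU; split => [/andP//|[-> ->]].
Qed.

Lemma hunionA (h1 h2 h3 : heap) :
  hunion h1 (hunion h2 h3) = hunion (hunion h1 h2) h3.
Proof. by apply: val_inj; rewrite /= catfA. Qed.

Lemma hunionC (h1 h2 : heap) : hdisj h1 h2 -> hunion h1 h2 = hunion h2 h1.
Proof.
move=> d; apply: val_inj; apply/fmapP => l; rewrite /= !fnd_cat.
case: ifPn => l2; case: ifPn => l1 //.
  by move/fdisjointP: d => /(_ _ l1); rewrite /dom l2.
by rewrite !not_fnd.
Qed.

Lemma hunionAC (h1 h2 h3 : heap) : hdisj h2 h3 ->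
  hunion (hunion h1 h2) h3 = hunion (hunion h1 h3) h2.
Proof. by move=> d; rewrite -!hunionA (hunionC d). Qed.

Lemma upd_id (V : eqType) (s : stack V) (x : V) : upd s x (s x) = s.
Proof. by apply/funext => y; rewrite /upd; case: eqP => [->|]. Qed.

Section Sepcon.
Context (R : realType) (V : eqType).
Implicit Types (X Y Z W : state V -> \bar R) (phi : set (state V)).

Lemma sepcon_ub X Y s (h1 h2 : heap) : hdisj h1 h2 ->
  (X (s, h1) * Y (s, h2) <= sepcon X Y (s, hunion h1 h2))%E.
Proof. by move=> d; apply: ereal_sup_ubound; exists (h1, h2). Qed.

Lemma sepcon_lub X Y W :
  (forall s h1 h2, hdisj h1 h2 ->
     (X (s, h1) * Y (s, h2) <= W (s, hunion h1 h2))%E) ->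
  exp_le (sepcon X Y) W.
Proof.
move=> XYW [s h]; apply: ge_ereal_sup => _ [[h1 h2] /= [d ->] <-].
exact: XYW.
Qed.

Lemma Vars_upd Y x (s : stack V) h v : ~ Vars Y x -> Y (upd s x v, h) = Y (s, h).
Proof.
move=> Yx; rewrite -{2}(upd_id s x); apply: contrapT => YY; apply: Yx.
by exists s, h, v, (s x).
Qed.

(** Half of the associativity of [sepcon]. The inner maximum is attained at a splitting of [h1],
    which can be regrouped with [h2]. *)
Lemma sepcon_iversonA phi X Y : is_expectation X -> is_expectation Y ->
  exp_le (sepcon (sepcon (iverson R phi) X) Y)
         (sepcon (iverson R phi) (sepcon X Y)).
Proof.
move=> X0 Y0; apply: sepcon_lub => s h1 h2 d.
have [k1 [k2 /= [dk e ->]]] := sepcon_max (iverson R phi) X (s, h1).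
move: d; rewrite e => /hdisjUl[d1 d2]; rewrite -hunionA -muleA.
apply: le_trans (sepcon_ub _ _ _ _); last by apply/hdisjUr.
by apply: lee_wpmul2l; [exact: iverson_ge0|exact: sepcon_ub].
Qed.

(** An extension disjoint from [hunion h1 h2] is disjoint from [h1], so it also competes in the
    infimum at [h1]. *)
Lemma sepcon_wand phi X Y : is_expectation Y ->
  exp_le (sepcon (wand phi X) Y) (wand phi (sepcon X Y)).
Proof.
move=> Y0; apply: sepcon_lub => s h1 h2 d.
apply: le_ereal_inf_tmp => _ [h' /= [/hdisjUr[d1 d2] ph] <-].
rewrite hunionAC; last exact: hdisjC.
apply: le_trans (sepcon_ub _ _ _ _); last by apply/hdisjUl.
by apply: lee_wpmul2r => //; apply: ereal_inf_lbound; exists h'.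
Qed.

(** This is where the side condition on modified variables enters: updating [x] leaves the factor
    [Y] unchanged. *)
Lemma sepcon_subst X Y x e : is_expectation Y -> ~ Vars Y x ->
  exp_le (sepcon (subst X x e) Y) (subst (sepcon X Y) x e).
Proof.
move=> Y0 Yx; apply: sepcon_lub => s h1 h2 d; rewrite /subst /=.
by rewrite -(Vars_upd s h2 (aeval s e) Yx); exact: sepcon_ub.
Qed.

(** Guards read only the stack, so they have the same value at [h1] and at [hunion h1 h2]. *)
Lemma sepcon_guarded b X X' Y :
  is_expectation X -> is_expectation X' -> is_expectation Y ->
  exp_le (sepcon (fun st => iverson R (guard b) st * X st
                            + iverson R (~` guard b) st * X' st)%E Y)
         (fun st => iverson R (guard b) st * sepcon X Y st
                    + iverson R (~` guard b) st * sepcon X' Y st)%E.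
Proof.
move=> X0 X'0 Y0; apply: sepcon_lub => s h1 h2 d.
have iv0 := @iverson_ge0 R V.
rewrite ge0_muleDl; try by apply: mule_ge0 => //; exact: iv0.
by rewrite -!muleA; apply: leeD; apply: lee_wpmul2l; rewrite ?iv0 //;
  exact: sepcon_ub.
Qed.

(** A quantitative magic wand. Taking the supremum of admissible factors, instead of an infimum of
    quotients [W / Y], avoids conventions for division by [0] and [+oo]. *)
Definition magic Y W : state V -> \bar R := fun st =>
  ereal_sup [set z | (0 <= z)%E /\ forall h, hdisj st.2 h ->
    (z * Y (st.1, h) <= W (st.1, hunion st.2 h))%E].

Lemma magic_ge0 Y W : is_expectation W -> is_expectation (magic Y W).
Proof.
move=> W0 st; apply: ereal_sup_ubound; split => // h _.
by rewrite mul0e.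
Qed.

(** The counit of the adjunction: each admissible [z] satisfies the bound, and [ereal_sup_mule_le]
    passes it to the supremum. *)
Lemma sepcon_magic Y W : is_expectation Y -> is_expectation W ->
  exp_le (sepcon (magic Y W) Y) W.
Proof.
move=> Y0 W0; apply: sepcon_lub => s h1 h2 d.
by apply: ereal_sup_mule_le => // z [_]; exact.
Qed.

Lemma le_magic Z Y W : is_expectation Z -> exp_le (sepcon Z Y) W ->
  exp_le Z (magic Y W).
Proof.
move=> Z0 ZYW [s h]; apply: ereal_sup_ubound; split => //= h' d.
exact: le_trans (sepcon_ub _ _ _ d) (ZYW _).
Qed.

End Sepcon.

Lemma wp_ge0 (R : realType) (V : eqType) (c : cmd V) (X : state V -> \bar R) :
  is_expectation X -> is_expectation (wp c X).
Proof. exact: (wp_ge0_le R c).1. Qed.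

Lemma wp_le (R : realType) (V : eqType) (c : cmd V) (X X' : state V -> \bar R) :
  is_expectation X -> exp_le X X' -> exp_le (wp c X) (wp c X').
Proof. exact: (wp_ge0_le R c).2. Qed.

(** Park induction: [lfp] is defined through fixed points, but by Knaster-Tarski it is below every
    prefixed point too. *)
Lemma wp_while_prefix (R : realType) (V : eqType) (b : bexp V) (c : cmd V)
  (X Y : state V -> \bar R) : is_expectation X -> is_expectation Y ->
  exp_le (fun st => iverson R (~` guard b) st * X st
             + iverson R (guard b) st * wp c Y st)%E Y ->
  exp_le (wp (While b c) X) Y.
Proof.
move=> X0 Y0 XY; have iv0 := @iverson_ge0 R V.
apply: lfp_least => // [Z Z0 st|Z Z' Z0 ZZ' st].
  by apply: adde_ge0; apply: mule_ge0 => //; [exact: iv0|exact: iv0|exact: wp_ge0].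
by apply: leeD => //; apply: lee_wpmul2l; [exact: iv0|exact: wp_le].
Qed.

Theorem theorem4p8 (R : realType) (V : eqType) (c : cmd V)
  (X Y : state V -> \bar R) (hX : is_expectation X) (hY : is_expectation Y)
  (hMod : Mod c `&` Vars Y = set0) :
  exp_le (sepcon (wp c X) Y) (wp c (sepcon X Y)).
Proof.
have {hMod} : forall x, Mod c x -> ~ Vars Y x.
  by move=> x cx Yx; have : (Mod c `&` Vars Y) x by []; rewrite hMod.
have iv0 := @iverson_ge0 R V.
elim: c X hX => [|x e|c1 IH1 c2 IH2|b c1 IH1 c2 IH2|b c IH|c1 IH1 p c2 IH2|x es
  |e e'|x e|e] X hX /= M.
- by [].
- by apply: sepcon_subst => //; exact: M.
- move=> st; apply: le_trans (IH1 _ (wp_ge0 c2 hX) _ st) _.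
    by move=> x ?; apply: M; left.
  apply: wp_le; first by apply: sepcon_ge0 => //; exact: wp_ge0.
  by apply: IH2 => // x ?; apply: M; right.
- move=> st; apply: le_trans (sepcon_guarded _ _ _ hY st) _; try exact: wp_ge0.
  apply: leeD; apply: lee_wpmul2l; rewrite ?iv0 //.
  + by apply: IH1 => // x ?; apply: M; left.
  + by apply: IH2 => // x ?; apply: M; right.
- have XY0 := sepcon_ge0 hX hY.
  set W := wp (While b c) (sepcon X Y).
  have W0 : is_expectation W by exact: wp_ge0.
  have m0 := magic_ge0 Y W0.
  move=> st; apply: le_trans (sepcon_magic hY W0 st); move: st.
  apply: sepcon_le => //; first exact: (wp_ge0 (While b c)).
  apply: (@wp_while_prefix _ _ b c) => //; apply: le_magic.
    by move=> st; apply: adde_ge0; apply: mule_ge0; rewrite ?iv0 //; exact: wp_ge0.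
  under eq_fun do rewrite addeC.
  move=> st; apply: le_trans (sepcon_guarded _ _ hX hY st) _; first exact: wp_ge0.
  (* Unfolding [W] once makes the exit branches agree. In the other branch, the induction hypothesis
     at [magic Y W] and monotonicity lead to [wp c W]. *)
  rewrite [leRHS](congr1 (@^~ st) (wp_while_fix b c XY0)) -/W addeC; apply: leeD => //.
  apply: lee_wpmul2l; first exact: iv0.
  apply: le_trans (IH _ m0 M st) _.
  by apply: wp_le; [exact: sepcon_ge0|exact: sepcon_magic].
- have [p0 q0] := prob_ge0 R p.
  have P1 := wp_ge0 c1 hX; have P2 := wp_ge0 c2 hX.
  apply: sepcon_lub => s h1 h2 d.
  rewrite ge0_muleDl; try by apply: mule_ge0; rewrite ?lee_fin.
  rewrite -!muleA; apply: leeD; apply: lee_wpmul2l; rewrite ?lee_fin //.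
  + apply: le_trans (IH1 _ hX _ _); first exact: sepcon_ub.
    by move=> x ?; apply: M; left.
  + apply: le_trans (IH2 _ hX _ _); first exact: sepcon_ub.
    by move=> x ?; apply: M; right.
- apply: sepcon_lub => s h1 h2 d.
  (* A block of addresses free in [hunion h1 h2] is free in [h1], so the same [v] is available in
     the infimum at [h1]. *)
  apply: le_ereal_inf_tmp => _ [v /= [v0 vh] <-].
  apply: le_trans (wand_le _ (sepcon_subst X (AConst v%:Z) hY (M x erefl)) _).
  apply: le_trans (sepcon_wand _ _ hY _).
  apply: le_trans (sepcon_ub _ _ _ d); apply: lee_wpmul2r => //.
  apply: ereal_inf_lbound; exists v => //; split => // i /vh.
  by rewrite dom_hunion in_fsetU negb_or => /andP[].
(* [Y] is carried past the old cell, then under the wand that adds the new one. *)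
- move=> st; apply: le_trans (sepcon_iversonA _ _ hY st) _; first exact: wand_ge0.
  apply: sepcon_le => //; last exact: sepcon_wand.
  by apply: sepcon_ge0 => //; exact: wand_ge0.
- have S0 v : is_expectation (subst X x (AConst v)) by move=> ?; exact: hX.
  have w0 v := wand_ge0 (pointsto e [:: AConst v]) (S0 v).
  (* The factor [Y] moves under the supremum over looked-up values; each [v] is then framed
     separately. *)
  apply: sepcon_lub => s h1 h2 d; apply: ereal_sup_mule_le => //.
    exact: (wp_ge0 (Lookup x e) (sepcon_ge0 hX hY)).
  move=> _ [v _ <-]; apply: le_ereal_sup_tmp; eexists; first by exists v.
  apply: le_trans (sepcon_ub _ _ _ d) _.
  apply: le_trans (sepcon_iversonA _ (w0 v) hY _) _.
  apply: sepcon_le => //; first exact: sepcon_ge0.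
  move=> st; apply: le_trans (sepcon_wand _ _ hY st) _.
  by apply: wand_le; apply: sepcon_subst => //; exact: M.
- exact: sepcon_iversonA.
Qed.
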